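(* Let $F$ be a field, and let $\Omega$ be the set of all $n\in\mathbb N$ such that every elementary grading on $M_n(F)$ (by any group $G$) can be regraded by a finite group, i.e. is weakly equivalent to a grading by a finite group. Then $\Omega=\lbrace n\in\mathbb N \mid 1\leqslant n\leqslant n_0\rbrace$ for some $3\leqslant n_0\leqslant 348$. In particular, for every $n\geqslant 349$ there exists an elementary grading on $M_n(F)$ that cannot be regraded by any finite group.
   Context: $\mathbb N$ is the set of positive integers. A grading $\Gamma\colon A=\bigoplus_{g\in G}A^{(g)}$ of an $F$-algebra $A$ by a group $G$ is a decomposition of $A$ into a direct sum of subspaces with $A^{(g)}A^{(h)}\subseteq A^{(gh)}$ for all $g,h\in G$ (components may be zero). Two gradings $\Gamma_1\colon A=\bigoplus_{s\in S}A^{(s)}$ and $\Gamma_2\colon B=\bigoplus_{t\in T}B^{(t)}$, where $S,T$ are groups, are weakly equivalent if there exists an algebra isomorphism $\varphi\colon A\to B$ such that for every $s\in S$ with $A^{(s)}\neq 0$ there exists $t\in T$ with $\varphi(A^{(s)})=B^{(t)}$. The elementary $G$-grading on $M_n(F)$ defined by an $n$-tuple $(g_1,\dots,g_n)$ of elements of a group $G$ is the grading in which each matrix unit $e_{ij}$ is homogeneous of degree $g_ig_j^{-1}$. *)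

(* Defs.v *)
From HB Require Import structures.
From mathcomp Require Import all_boot all_order all_algebra all_fingroup all_field.

Set Implicit Arguments.
Unset Strict Implicit.
Unset Printing Implicit Defensive.

Import GRing.Theory.
Local Open Scope ring_scope.

(* G may be infinite: the sum of the components is direct when every finite    *)
(* subfamily is independent, and, A being finite-dimensional, it is all of A   *)
(* exactly when some finite subfamily spans A.                                 *)
Record grading (F : fieldType) (A : falgType F) (G : groupType) := Grading {
  component :> G -> {vspace A};
  grading_direct : forall (s : seq G) (a : G -> A), uniq s ->
    (forall g, a g \in component g) -> \sum_(g <- s) a g = 0 ->
    forall g, g \in s -> a g = 0;
  grading_full : exists s : seq G, (\sum_(g <- s) component g)%VS = fullv;
  grading_mul : forall g h : G,
    (component g * component h <= component (g * h)%g)%VS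
}.

Definition weakly_equivalent (F : fieldType) (A B : falgType F) (S T : groupType)
    (Gamma1 : grading A S) (Gamma2 : grading B T) : Prop :=
  exists phi : 'AHom(A, B), bijective phi /\
    forall s : S, Gamma1 s != 0%VS -> exists t : T, (phi @: Gamma1 s)%VS = Gamma2 t.

Definition regraded_by (F : fieldType) (A : falgType F) (G : groupType)
    (Gamma : grading A G) (T : groupType) : Prop :=
  exists (B : falgType F) (Gamma' : grading B T), weakly_equivalent Gamma Gamma'.

Section Elementary.

Variables (F : fieldType) (n : nat) (G : groupType) (g : 'I_n.+1 -> G).

(* Only 'M_n.+1 carries a falgType structure, hence the successor dimension. *)
Definition elementary_component (h : G) : {vspace 'M[F]_n.+1} :=
  (\sum_i \sum_(j | (g i * (g j)^-1)%g == h) <[delta_mx i j]>)%VS.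

Lemma delta_elementary_component i j :
  delta_mx i j \in elementary_component (g i * (g j)^-1)%g.
Proof.
by rewrite memvE; apply: (sumv_sup i) => //; apply: (sumv_sup j).
Qed.

Lemma mem_elementary_component (h : G) (a : 'M[F]_n.+1) :
  reflect (forall i j, a i j != 0 -> (g i * (g j)^-1)%g = h)
          (a \in elementary_component h).
Proof.
apply: (iffP idP) => [/memv_sumP[u uP ->] i j | aP]; last first.
  rewrite [a]matrix_sum_delta; apply: memv_suml => i _; apply: memv_suml => j _.
  have [->|/aP <-] := eqVneq (a i j) 0; first by rewrite scale0r mem0v.
  exact/memvZ/delta_elementary_component.
apply: contraNeq => hN; rewrite summxE big1 // => k _.
have /memv_sumP[v vP ->] := uP k isT; rewrite summxE big1 // => l hl.
have /vlineP[c ->] := vP l hl; rewrite !mxE.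
by case: eqP => [ik|]; case: eqP => [jl|]; rewrite ?mulr0 //;
   rewrite ik jl hl in hN.
Qed.

Lemma elementary_direct (s : seq G) (a : G -> 'M[F]_n.+1) : uniq s ->
  (forall h, a h \in elementary_component h) -> \sum_(h <- s) a h = 0 ->
  forall h, h \in s -> a h = 0.
Proof.
move=> s_uniq aP a0 h hs; apply/matrixP => i j; rewrite mxE.
have aE k : a k i j != 0 -> (g i * (g j)^-1)%g = k.
  by move: i j; apply/mem_elementary_component.
apply/eqP; apply: contraT => /[dup] /aE eh /eqP[].
have := congr1 (fun b : 'M_n.+1 => b i j) a0.
rewrite summxE mxE (bigD1_seq h) //= big1 ?addr0 // => k kh.
by apply: contraNeq kh => /aE <-; rewrite eh.
Qed.

Lemma elementary_full :
  exists s : seq G, (\sum_(h <- s) elementary_component h)%VS = fullv.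
Proof.
pose s := [seq (g p.1 * (g p.2)^-1)%g | p : 'I_n.+1 * 'I_n.+1].
exists s; apply/eqP; rewrite eqEsubv subvf /=; apply/subvP => a _.
rewrite [a]matrix_sum_delta; apply: memv_suml => i _; apply: memv_suml => j _.
apply: memvZ; have hs : (g i * (g j)^-1)%g \in s.
  by apply/mapP; exists (i, j); rewrite ?mem_enum.
rewrite memvE (big_rem _ hs) /=; apply: subv_trans (addvSl _ _).
by rewrite -memvE delta_elementary_component.
Qed.

Lemma elementary_mul (h k : G) :
  (elementary_component h * elementary_component k
     <= elementary_component (h * k)%g)%VS.
Proof.
apply/prodvP => a b /mem_elementary_component aP /mem_elementary_component bP.
apply/mem_elementary_component => i j; rewrite -mulmxE mxE => abN.
have [l] : exists l, a i l * b l j != 0.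
  apply/existsP; apply: contraNT abN; rewrite negb_exists => /forallP ab0.
  by rewrite big1 // => l _; apply/eqP; rewrite -[_ == _]negbK ab0.
rewrite mulf_eq0 negb_or => /andP[/aP <- /bP <-].
by rewrite mulgA mulgKV.
Qed.

Definition elementary_grading : grading 'M[F]_n.+1 G :=
  Grading elementary_direct elementary_full elementary_mul.

End Elementary.

(* 0 is excluded: Omega is a set of positive integers. *)
Definition Omega (F : fieldType) (n : nat) : Prop :=
  match n with
  | 0 => False
  | m.+1 => forall (G : groupType) (g : 'I_m.+1 -> G),
      exists T : finGroupType, regraded_by (elementary_grading F g) T
  end.

(* Main.v *)
Require Import Defs.
From HB Require Import structures.
From mathcomp Require Import all_boot all_order all_algebra all_fingroup all_field.
From mathcomp Require Import cyclic.
From mathcomp Require Import boolp.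

(** In the elementary grading given by a tuple [g], the matrix units [e_ij] and
[e_kl] share a component exactly when [g_i g_j^-1 = g_k g_l^-1].  A regrading by
a group [T] moves [e_ij] to some degree [t_ij], and [e_ij e_jk = e_ik <> 0]
forces [t_ij t_jk = t_ik], whence [t_ij = h_i h_j^-1] with [h_i = t_i0]:
regradings of elementary gradings are again elementary.  So regrading by a
finite group means finding a tuple in a finite group that has the same
coincidences between its quotients as [g] ([regraded_elementaryP]), and the
question becomes purely group-theoretic.

A good size stays good when it decreases, because a tuple can be lengthened by
repeating an entry and its model shortened again ([Omega_leq]).

Size 3 is good: the quotients of a triple are [x], [y], [z] with [x y z = 1],
their inverses and 1, and the possible coincidences among them are few enough
to be realized one by one in small cyclic groups, in the Klein group and in the
symmetric group on three letters ([finite_triangleP]).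

Size 10 is bad.  If [t a^2 t^-1 = a^3] in a finite group, then [a^2] and [a^3]
have equal orders, so the order of [a] is prime to 2 and [a] is a power of
[a^2]; hence [t a t^-1] is a power of [a^3] and commutes with [a]
([finite_BS23_commute]).  This is the classical reason why the Baumslag-Solitar
group BS(2,3) is not residually finite.  The ten elements
[1, a, a^2, t, at, a^2 t, a^3 t, ta, ata, a^-1 t] suffice to force both the
relation and the two products [a t a t^-1] and [t a t^-1 a] onto every tuple
with the same coincidences ([BS23_obstruction]).  Permutations of the rationals
supply [a] and [t] for which these products differ: [a] is the translation by 1,
and [t] is the scaling by 3/2 composed with a permutation that commutes with the
translation by 2 but not with the translation by 1.  Longer tuples containing
the same ten elements are bad as well ([no_finite_model]).  Hence the good sizes
are those from 1 to some bound between 3 and 9. *)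

(** * Regradings of elementary gradings *)

Section QuotientPatterns.

Set Implicit Arguments.
Unset Strict Implicit.
Unset Printing Implicit Defensive.

Local Open Scope group_scope.

Definition same_quotients (I : Type) (G T : groupType) (g : I -> G) (h : I -> T)
    : Prop :=
  forall i j k l : I,
    (g i * (g j)^-1 == g k * (g l)^-1) = (h i * (h j)^-1 == h k * (h l)^-1).

Lemma same_quotients_comp (I J : Type) (G T : groupType) (g : I -> G)
    (h : I -> T) (f : J -> I) :
  same_quotients g h -> same_quotients (g \o f) (h \o f).
Proof. by move=> gh i j k l; apply: gh. Qed.

Lemma homogeneous_degree_uniq (F : fieldType) (A : falgType F) (G : groupType)
    (Gamma : grading A G) (s t : G) (v : A) :
  v != 0%R -> v \in Gamma s -> v \in Gamma t -> s = t.
Proof.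
move=> v0 vs vt; apply/eqP; apply: contraNT v0 => st; apply/eqP.
pose a r : A := if r == s then v else if r == t then (- v)%R else 0%R.
have a0 : a s = 0%R; last by move: a0; rewrite /a eqxx => ->.
apply: (@grading_direct _ _ _ Gamma [:: s; t] a); rewrite ?mem_head //=.
- by rewrite inE st.
- move=> r; rewrite /a; case: eqVneq => [->//|_].
  by case: eqVneq => [->|_]; rewrite ?memvN ?mem0v.
by rewrite big_cons big_seq1 /a !eqxx eq_sym (negPf st) GRing.subrr.
Qed.

(** The right-to-left direction keeps the algebra and only changes the labels of
the components; the left-to-right direction is the cocycle argument, where the
degrees of the first column of matrix units provide the tuple. *)
Lemma regraded_elementaryP (F : fieldType) (n : nat) (G T : groupType)
    (g : 'I_n.+1 -> G) :
  regraded_by (elementary_grading F g) T <->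
  exists h : 'I_n.+1 -> T, same_quotients g h.
Proof.
split=> [[B [Gamma [phi [phi_bij phiP]]]]|[h gh]]; last first.
  exists 'M[F]_n.+1, (elementary_grading F h), \1%AF; split.
    by exists id => v; rewrite lfunE.
  move=> s s0; have [i /existsP[j /eqP ijs]] :
      exists i, [exists j, g i * (g j)^-1 == s].
    apply/existsP; apply: contraNT s0; rewrite negb_exists => /forallP sN.
    rewrite -subv0; apply/subvP => v /mem_elementary_component vs.
    rewrite memv0; apply/eqP/matrixP => i j; rewrite mxE.
    apply/eqP; apply: contraT => /vs ijs; have := sN i.
    by rewrite negb_exists => /forallP/(_ j); rewrite ijs eqxx.
  exists (h i * (h j)^-1); rewrite lim1g; apply/vspaceP => v.
  apply/mem_elementary_component/mem_elementary_component => vs k l /vs.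
    by rewrite -ijs => /eqP; rewrite gh => /eqP.
  by move=> /eqP; rewrite -gh ijs => /eqP.
have phi_inj := bij_inj phi_bij.
pose e i j : 'M[F]_n.+1 := delta_mx i j.
have e0 i j : e i j != 0%R.
  by apply/eqP => /matrixP/(_ i j)/eqP; rewrite !mxE !eqxx GRing.oner_eq0.
have phie0 i j : phi (e i j) != 0%R.
  by rewrite -(GRing.linear0 phi) (inj_eq phi_inj).
have [t tP] : exists t : 'I_n.+1 -> 'I_n.+1 -> T, forall i j,
    (phi @: elementary_grading F g (g i * (g j)^-1)%g)%VS = Gamma (t i j).
  pose P (p : 'I_n.+1 * 'I_n.+1) (u : T) :=
    (phi @: elementary_grading F g (g p.1 * (g p.2)^-1)%g)%VS = Gamma u.
  have [p|u uP] := @fin_all_exists _ (fun=> T) P; last first.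
    by exists (fun i j => u (i, j)) => i j; apply: (uP (i, j)).
  apply: phiP; apply/negP => /eqP p0.
  have := delta_elementary_component F g p.1 p.2.
  by rewrite -[elementary_component _ _ _]/(elementary_grading F g _) p0 memv0
    (negPf (e0 _ _)).
have phieP i j : phi (e i j) \in Gamma (t i j).
  by rewrite -tP memv_img // delta_elementary_component.
have tM i j k : t i j * t j k = t i k.
  apply: (homogeneous_degree_uniq (phie0 i k)) => //.
  have -> : phi (e i k) = (phi (e i j) * phi (e j k))%R.
    by rewrite -GRing.rmorphM -mulmxE mul_delta_mx.
  exact: subvP (grading_mul _ _ _) _ (memv_mul (phieP i j) (phieP j k)).
have tV i j : t i j = t i ord0 * (t j ord0)^-1 by rewrite -(tM i j ord0) mulgK.
exists (t^~ ord0) => i j k l; rewrite -!tV; apply/eqP/eqP => [gE|tE].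
  apply: (homogeneous_degree_uniq (phie0 i j)) => //.
  by rewrite -tP -gE tP.
suff /mem_elementary_component ek :
    e i j \in elementary_grading F g (g k * (g l)^-1).
  by apply: ek; rewrite mxE !eqxx GRing.oner_eq0.
have: phi (e i j) \in Gamma (t k l) by rewrite -tE.
by rewrite -tP => /memv_imgP[v vs /phi_inj ->].
Qed.

Lemma Omega_succP (F : fieldType) (n : nat) :
  Omega F n.+1 <->
  forall (G : groupType) (g : 'I_n.+1 -> G),
    exists (T : finGroupType) (h : 'I_n.+1 -> T), same_quotients g h.
Proof.
split=> gP G g; have [T gT] := gP G g; exists T.
  by move/regraded_elementaryP: gT.
exact/regraded_elementaryP.
Qed.

(** [inord] sends the indices beyond the shorter tuple to its first entry, so
that precomposing with it lengthens the tuple without new quotients. *)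
Lemma Omega_leq (F : fieldType) (m n : nat) :
  0 < m -> m <= n -> Omega F n -> Omega F m.
Proof.
case: m n => [|m] [|n] // _ lemn /Omega_succP On; apply/Omega_succP => G g.
pose f (i : 'I_n.+1) : 'I_m.+1 := inord i.
have fK : cancel (widen_ord lemn) f.
  by move=> i; apply/val_inj; apply: inordK (ltn_ord i).
have [T [h gh]] := On G (g \o f); exists T, (h \o widen_ord lemn).
have -> : g = (g \o f) \o widen_ord lemn.
  by apply/funext => i /=; rewrite fK.
exact: same_quotients_comp.
Qed.

End QuotientPatterns.

(** * Triples *)

Section Triangles.

Set Implicit Arguments.
Unset Strict Implicit.
Unset Printing Implicit Defensive.

Local Open Scope group_scope.

(** When [x * y * z = 1], these nine tests decide every coincidence among 1,
[x], [y], [z] and their inverses; for instance [x = y^-1] amounts to [z = 1]. *)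
Definition triangle_type (G : groupType) (x y z : G) : seq bool :=
  [:: x == 1; y == 1; z == 1; x * x == 1; y * y == 1; z * z == 1;
      x == y; y == z; z == x].

Definition finite_triangle (b : seq bool) : Prop :=
  exists (T : finGroupType) (x y z : T),
    x * y * z = 1 /\ triangle_type x y z = b.

Lemma mul3_rot (G : groupType) (x y z : G) : x * y * z = 1 -> y * z * x = 1.
Proof. by rewrite -mulgA => /(canRL (mulKg x)) ->; rewrite mulg1 mulVg. Qed.

(** The relation [x * y * z = 1] is invariant under cyclic shifts, and the tests
are listed so that a shift rotates each of the three blocks. *)
Lemma finite_triangle_rot (a b c a' b' c' a'' b'' c'' : bool) :
  finite_triangle [:: a; b; c; a'; b'; c'; a''; b''; c''] ->
  finite_triangle [:: b; c; a; b'; c'; a'; b''; c''; a''].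
Proof.
case=> T [x [y [z [xyz1 [<- <- <- <- <- <- <- <- <-]]]]].
by exists T, y, z, x; split; first exact: mul3_rot.
Qed.

(** Two distinct involutions whose product is not an involution: two reflections
of a triangle. *)
Lemma S3_triangle :
  finite_triangle
    [:: false; false; false; true; true; false; false; false; false].
Proof.
pose s : {perm 'I_3} := tperm (Ordinal (isT : 0 < 3)) (Ordinal (isT : 1 < 3)).
pose t : {perm 'I_3} := tperm (Ordinal (isT : 1 < 3)) (Ordinal (isT : 2 < 3)).
have ss : s * s = 1 by rewrite tperm2.
have tt : t * t = 1 by rewrite tperm2.
have neq i (u v : {perm 'I_3}) : u i != v i -> (u == v) = false.
  by move=> uv; apply: contraNF uv => /eqP ->.
exists {perm 'I_3}, s, t, (t * s); split.
  by rewrite mulgA -(mulgA s) tt mulg1.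
rewrite /triangle_type ss tt !eqxx [t == t * s](neq ord0) ?permM ?permE //.
by rewrite !(neq (Ordinal (isT : 1 < 3))) ?permM ?perm1 ?permE.
Qed.

(** If some entry is 1, the other two are mutually inverse, and it only matters
whether one of them is 1, an involution or neither.  If none is 1 but [x = y],
then [z = x^-2], so the triple generates a cyclic group.  Otherwise the only
remaining data are which of the three entries are involutions. *)
Lemma finite_triangleP (G : groupType) (x y z : G) :
  x * y * z = 1 -> finite_triangle (triangle_type x y z).
Proof.
have deg (u v w : G) : u * v * w = 1 -> u == 1 ->
    finite_triangle (triangle_type u v w).
  move=> uvw /eqP u1; move: uvw; rewrite u1 mul1g => vw.
  have -> : w = v^-1 by rewrite -[LHS](mulKg v) vw mulg1.
  rewrite /triangle_type mul1g eqxx -invMg !invg_eq1.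
  rewrite [1 == v]eq_sym -[v == v^-1](inj_eq (mulgI v)) mulgV.
  case: eqVneq => [->|v1].
    exists 'I_1, 1, 1, 1; split; first by rewrite !mulg1.
    by rewrite /triangle_type !mulg1 !eqxx.
  case: (v * v == 1).
    by exists 'I_2, (inZp 0), (inZp 1), (inZp 1); split=> //; apply/val_inj.
  by exists 'I_3, (inZp 0), (inZp 1), (inZp 2); split=> //; apply/val_inj.
move=> xyz; have yzx := mul3_rot xyz; have zxy := mul3_rot yzx.
have [x1|x1] := boolP (x == 1); first exact: deg.
have [y1|y1] := boolP (y == 1).
  by do 2!apply: finite_triangle_rot; apply: deg yzx y1.
have [z1|z1] := boolP (z == 1).
  by apply: finite_triangle_rot; apply: deg zxy z1.
have iso (u v w : G) :
    u * v * w = 1 -> u != 1 -> w != 1 -> u == v ->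
    finite_triangle (triangle_type u v w).
  move=> uvw u1 w1 /eqP uv; rewrite -{v}uv in uvw *.
  have uu : u * u != 1 by apply: contraNneq w1 => uu; rewrite -uvw uu mul1g.
  rewrite /triangle_type (negPf uu) !eqxx.
  rewrite (negPf u1) (negPf w1) [w == u]eq_sym.
  case: (eqVneq u w) => [<-|uw].
    rewrite (negPf uu).
    by exists 'I_3, (inZp 1), (inZp 1), (inZp 1); split=> //; apply/val_inj.
  case: (w * w == 1).
    by exists 'I_4, (inZp 1), (inZp 1), (inZp 2); split=> //; apply/val_inj.
  by exists 'I_5, (inZp 1), (inZp 1), (inZp 3); split=> //; apply/val_inj.
have [xy|xy] := boolP (x == y); first exact: iso.
have [yz|yz] := boolP (y == z).
  by do 2!apply: finite_triangle_rot; apply: iso yzx y1 x1 yz.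
have [zx|zx] := boolP (z == x).
  by apply: finite_triangle_rot; apply: iso zxy z1 y1 zx.
rewrite /triangle_type.
have S3 := S3_triangle.
rewrite !(negPf x1, negPf y1, negPf z1, negPf xy, negPf yz, negPf zx).
case: (x * x == 1); case: (y * y == 1); case: (z * z == 1) => //.
- exists ('I_2 * 'I_2)%type.
  exists (inZp 0, inZp 1), (inZp 1, inZp 0), (inZp 1, inZp 1).
  by split=> //; congr pair; apply/val_inj.
- exact: finite_triangle_rot.
- by exists 'I_6, (inZp 3), (inZp 1), (inZp 2); split=> //; apply/val_inj.
- by do 2!apply: finite_triangle_rot.
- by exists 'I_6, (inZp 2), (inZp 3), (inZp 1); split=> //; apply/val_inj.
- by exists 'I_6, (inZp 1), (inZp 2), (inZp 3); split=> //; apply/val_inj.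
- by exists 'I_7, (inZp 1), (inZp 2), (inZp 4); split=> //; apply/val_inj.
Qed.

Lemma triangle_eqE (G : groupType) (x y z : G) : x * y * z = 1 ->
  ((1 == x) = (x == 1)) * ((1 == y) = (y == 1)) * ((1 == z) = (z == 1)) *
  ((x == x^-1) = (x * x == 1)) * ((y == y^-1) = (y * y == 1)) *
  ((z == z^-1) = (z * z == 1)) *
  ((x^-1 == x) = (x * x == 1)) * ((y^-1 == y) = (y * y == 1)) *
  ((z^-1 == z) = (z * z == 1)) *
  ((y == x) = (x == y)) * ((z == y) = (y == z)) * ((x == z) = (z == x)) *
  ((x == y^-1) = (z == 1)) * ((y == x^-1) = (z == 1)) *
  ((y == z^-1) = (x == 1)) * ((z == y^-1) = (x == 1)) *
  ((z == x^-1) = (y == 1)) * ((x == z^-1) = (y == 1)) *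
  ((x^-1 == y) = (z == 1)) * ((y^-1 == x) = (z == 1)) *
  ((y^-1 == z) = (x == 1)) * ((z^-1 == y) = (x == 1)) *
  ((z^-1 == x) = (y == 1)) * ((x^-1 == z) = (y == 1)).
Proof.
move=> xyz; have yzx := mul3_rot xyz; have zxy := mul3_rot yzx.
have invE (u v : G) : (u == v^-1) = (u * v == 1).
  by rewrite -[RHS](inj_eq (mulIg v^-1)) mulgK mul1g.
have mul1 (u v w : G) : u * v * w = 1 -> (u * v == 1) = (w == 1).
  by move=> /(canRL (mulgK w)) ->; rewrite mul1g invg_eq1.
have mul1' (u v w : G) : u * v * w = 1 -> (v * u == 1) = (w == 1).
  by move=> /mul1 <-; rewrite -!invE eq_sym -[LHS](inj_eq invg_inj) invgK.
by rewrite ![_^-1 == _]eq_sym !invE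
  (mul1 _ _ _ xyz) (mul1 _ _ _ yzx) (mul1 _ _ _ zxy)
  (mul1' _ _ _ xyz) (mul1' _ _ _ yzx) (mul1' _ _ _ zxy);
  do !split=> //; apply: eq_sym.
Qed.

Lemma finite_same_quotients3 (G : groupType) (g : 'I_3 -> G) :
  exists (T : finGroupType) (h : 'I_3 -> T), same_quotients g h.
Proof.
pose quot (K : groupType) (x y z : K) (i j : nat) : K :=
  match i, j with
  | 0, 1 => x | 1, 2 => y | 2, 0 => z
  | 1, 0 => x^-1 | 2, 1 => y^-1 | 0, 2 => z^-1
  | _, _ => 1
  end.
pose quotf (K : groupType) (f : nat -> K) :=
  quot K (f 0 * (f 1%N)^-1) (f 1%N * (f 2)^-1) (f 2 * (f 0)^-1).
have quotE (K : groupType) (f : nat -> K) (i j : 'I_3) :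
    f i * (f j)^-1 = quotf K f i j.
  by rewrite /quotf; case: i j => [[|[|[|//]]] ?] [[|[|[|//]]] ?];
    rewrite /= ?mulgV ?invMg ?invgK.
have quot1 (K : groupType) (f : nat -> K) :
    f 0 * (f 1%N)^-1 * (f 1%N * (f 2)^-1) * (f 2 * (f 0)^-1) = 1.
  by rewrite !mulgA !mulgKV mulgV.
pose f k := g (inord k).
have [T [x [y [z [xyz1]]]]] := finite_triangleP (quot1 G f).
have := quot1 G f; set X := f 0 * _; set Y := f 1%N * _; set Z := f 2 * _.
move=> XYZ [ex ey ez exx eyy ezz exy eyz ezx].
(* the tuple with consecutive quotients [x] and [y] and middle entry 1 *)
pose h k := nth 1 [:: x; 1; y^-1] k.
exists T, (fun i => h i) => i j k l.
rewrite -[i in LHS]inord_val -[j in LHS]inord_val -[k in LHS]inord_val.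
rewrite -[l in LHS]inord_val -![g (inord _)]/(f _) !quotE.
have -> : quotf T h = quot T x y z.
  have zE : z = y^-1 * x^-1.
    by rewrite -invMg -[LHS](mulKg (x * y)) xyz1 mulg1.
  by rewrite /quotf /h /= invg1 mulg1 mul1g invgK -zE.
rewrite /quotf -/X -/Y -/Z.
have eG := triangle_eqE XYZ; have eT := triangle_eqE xyz1.
by case: i j k l => [[|[|[|//]]] ?] [[|[|[|//]]] ?]
                    [[|[|[|//]]] ?] [[|[|[|//]]] ?];
  rewrite /= ?eqxx // ?[1 == _]eq_sym ?invg_eq1 ?(inj_eq invg_inj) ?eG ?eT.
Qed.

End Triangles.

(** * A relation with unavoidable consequences in finite groups *)

Section Obstruction.

Set Implicit Arguments.
Unset Strict Implicit.
Unset Printing Implicit Defensive.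

Local Open Scope group_scope.

(** Conjugate elements have equal orders, so the gcds of the order of [a] with 2
and with 3 agree, hence are 1. *)
Lemma finite_BS23_commute (T : finGroupType) (a t : T) :
  t * (a * a) = a * (a * (a * t)) -> a * (t * a * t^-1) = t * a * t^-1 * a.
Proof.
move=> ta; have aaJ : (a ^+ 2) ^ t^-1 = a ^+ 3.
  by rewrite conjgE invgK !expgS expg0 mulg1 mulgA ta !mulgA mulgK.
have gcd23 : gcdn #[a] 2 = gcdn #[a] 3.
  have := congr1 order aaJ; rewrite orderJ !orderXgcd => e.
  have d n : #[a] %/ (#[a] %/ gcdn #[a] n) = gcdn #[a] n.
    by rewrite divnA ?dvdn_gcdl // mulnC mulnK.
  by rewrite -d e d.
have a2 : coprime #[a] 2.
  have : gcdn #[a] 2 %| gcdn 2 3 by rewrite dvdn_gcd dvdn_gcdr gcd23 dvdn_gcdr.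
  by rewrite dvdn1.
have /cycleP[k ak] : a \in <[a ^+ 2]>.
  by move: a2; rewrite -generator_coprime => /eqP <-; apply: cycle_id.
have -> : t * a * t^-1 = a ^+ (3 * k).
  by rewrite expgM -aaJ -conjXg -ak conjgE invgK mulgA.
by rewrite -expgS -expgSr.
Qed.

(** Coincidences of quotients turn products into products: if [u = v w] with
[u], [v], [w] and 1 in the tuple, then [u w^-1 = v 1^-1].  The first seven
entries force the relation on any model.  The last three give both sides of the
inequation as quotients, [(ata) t^-1] and [(ta) (a^-1 t)^-1], so that a finite
model would have a coincidence that the tuple lacks. *)
Lemma BS23_obstruction (G : groupType) (a t : G) (n : nat) :
  t * (a * a) = a * (a * (a * t)) ->
  a * (t * a * t^-1) != t * a * t^-1 * a ->
  9 <= n ->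
  exists g : 'I_n.+1 -> G, forall (T : finGroupType) (h : 'I_n.+1 -> T),
    ~ same_quotients g h.
Proof.
move=> ta nab le9n.
pose s := [:: 1; a; a * a; t; a * t; a * (a * t); a * (a * (a * t)); t * a;
               a * (t * a); a^-1 * t].
exists (fun i => nth 1 s i) => T h gh.
(* normalized so that the entry modelling 1 is 1 *)
pose H k := h (inord k) * (h (inord 0))^-1.
have HE i j k l : [&& i < 10, j < 10, k < 10 & l < 10] ->
    (nth 1 s i * (nth 1 s j)^-1 == nth 1 s k * (nth 1 s l)^-1) =
    (H i * (H j)^-1 == H k * (H l)^-1).
  have r m : m < 10 -> (inord m : 'I_n.+1) = m :> nat.
    by move=> m10; rewrite inordK //; apply: leq_trans m10 _.
  case/and4P=> i10 j10 k10 l10.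
  have := gh (inord i) (inord j) (inord k) (inord l).
  by rewrite !r // => ->; rewrite /H !invMg !invgK !mulgA !mulgKV.
have H0 : H 0%N = 1 by rewrite /H mulgV.
(* otherwise rewriting sees products inside the entries of the model *)
clearbody H.
(* [s_i s_j^-1 = s_b = s_b s_0^-1], and the same for [H], where [H 0 = 1] *)
have step b i j : [&& b < 10, i < 10 & j < 10] ->
    nth 1 s i = nth 1 s b * nth 1 s j -> H i = H b * H j.
  case/and3P=> b10 i10 j10 e.
  have := HE i j b 0%N; rewrite b10 i10 j10 e /=.
  rewrite invg1 mulg1 mulgK eqxx H0 invg1 mulg1.
  by move=> /(_ isT)/esym/eqP <-; rewrite mulgKV.
have H2 : H 2 = H 1%N * H 1%N by apply: step.
have H4 : H 4 = H 1%N * H 3 by apply: step.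
have H5 : H 5 = H 1%N * H 4 by apply: step.
have H6 : H 6 = H 1%N * H 5 by apply: step.
have H6' : H 6 = H 3 * H 2 by apply: step.
have H7 : H 7 = H 3 * H 1%N by apply: step.
have H8 : H 8 = H 1%N * H 7 by apply: step.
have H3 : H 3 = H 1%N * H 9 by apply: step => //=; rewrite mulVKg.
have rel : H 3 * (H 1%N * H 1%N) = H 1%N * (H 1%N * (H 1%N * H 3)).
  by rewrite -H2 -H6' H6 H5 H4.
have := HE 8 3 7 9 isT; rewrite /= H8 H7 -(mulKg (H 1%N) (H 9)) -H3.
rewrite !invMg !invgK !mulgA.
have := finite_BS23_commute rel; rewrite !mulgA => ->; rewrite eqxx => /eqP e.
by case/eqP: nab; rewrite !mulgA.
Qed.

End Obstruction.

(** * Permutations of the rationals *)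

Section Bijections.

Set Implicit Arguments.
Unset Strict Implicit.
Unset Printing Implicit Defensive.

Variable X : choiceType.

(** Pairs of mutually inverse maps, so that inversion is the exchange of the two
components and needs no choice. *)
Definition bijection_pred : pred ((X -> X) * (X -> X)) :=
  fun p => `[< cancel p.1 p.2 /\ cancel p.2 p.1 >].

Record bijection := Bijection {
  bijection_val : (X -> X) * (X -> X);
  bijectionP : bijection_pred bijection_val
}.

HB.instance Definition _ := [isSub for bijection_val].
HB.instance Definition _ := [Choice of bijection by <:].

Definition bij_of (f f' : X -> X) (fK : cancel f f') (f'K : cancel f' f) :=
  @Bijection (f, f') (asboolT (conj fK f'K)).

Definition bij_fun (f : bijection) : X -> X := (bijection_val f).1.

Lemma bij_funK f : cancel (bij_fun f) (bijection_val f).2.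
Proof. by have /asboolP[] := bijectionP f. Qed.

Lemma bij_funVK f : cancel (bijection_val f).2 (bij_fun f).
Proof. by have /asboolP[] := bijectionP f. Qed.

Lemma bijection_eq (f g : bijection) : bij_fun f =1 bij_fun g -> f = g.
Proof.
move=> fg; apply: val_inj; apply: injective_projections; apply/funext => x //=.
  exact: fg.
by rewrite -{1}(bij_funVK g x) -fg bij_funK.
Qed.

Definition bij_one : bijection := @bij_of id id (fun=> erefl) (fun=> erefl).

Definition bij_inv (f : bijection) : bijection :=
  bij_of (bij_funVK f) (bij_funK f).

Definition bij_mul (f g : bijection) : bijection :=
  bij_of (can_comp (bij_funK f) (bij_funK g))
         (can_comp (bij_funVK g) (bij_funVK f)).

Fact bij_mulA : associative bij_mul.
Proof. by move=> f g h; apply: bijection_eq. Qed.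
Fact bij_mul1 : left_id bij_one bij_mul.
Proof. by move=> f; apply: bijection_eq. Qed.
Fact bij_mulr1 : right_id bij_one bij_mul.
Proof. by move=> f; apply: bijection_eq. Qed.
Fact bij_mulV : left_inverse bij_one bij_inv bij_mul.
Proof. by move=> f; apply: bijection_eq => x; apply: bij_funK. Qed.
Fact bij_mulVr : right_inverse bij_one bij_inv bij_mul.
Proof. by move=> f; apply: bijection_eq => x; apply: bij_funVK. Qed.

HB.instance Definition _ :=
  isGroup.Build bijection bij_mulA bij_mul1 bij_mulr1 bij_mulV bij_mulVr.

End Bijections.

Section RationalPermutations.

Import GRing.Theory.
Local Open Scope ring_scope.

Definition shift_even (e x : rat) : rat :=
  if x / 2 \is a Num.int then x + e else x.

Lemma shift_evenK (e : rat) :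
  e / 2 \is a Num.int -> cancel (shift_even e) (shift_even (- e)).
Proof.
move=> e2 x; rewrite /shift_even; case: (boolP (x / 2 \is a Num.int)) => xP.
  by rewrite mulrDl rpredD // addrK.
by rewrite (negPf xP).
Qed.

Fact shift_even2K : cancel (shift_even 2) (shift_even (- 2)).
Proof. exact: shift_evenK. Qed.

Fact shift_even2VK : cancel (shift_even (- 2)) (shift_even 2).
Proof. by rewrite -{2}[2]opprK; apply: shift_evenK. Qed.

Fact scale32K : cancel ( *%R (3 / 2 : rat)) ( *%R (2 / 3 : rat)).
Proof. by move=> x; rewrite mulrA mul1r. Qed.

Fact scale32VK : cancel ( *%R (2 / 3 : rat)) ( *%R (3 / 2 : rat)).
Proof. by move=> x; rewrite mulrA mul1r. Qed.

Definition translate1 : bijection rat := bij_of (addrK 1) (subrK 1).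

(** The scaling already conjugates the translation by 2 to the translation by 3;
the shift of the even integers commutes with the former, so it keeps this
relation, while it spoils the commutation with the translation by 1. *)
Definition twisted_scaling : bijection rat :=
  (bij_of scale32K scale32VK * bij_of shift_even2K shift_even2VK)%g.

Local Notation a := translate1.
Local Notation t := twisted_scaling.

Lemma twisted_scaling_rel : (t * (a * a) = a * (a * (a * t)))%g.
Proof.
apply: bijection_eq => x.
rewrite -[LHS]/(3 / 2 * shift_even 2 (x + 1 + 1)).
rewrite -[RHS]/(3 / 2 * shift_even 2 x + 1 + 1 + 1).
have three : 1 + (1 + 1) = 3 / 2 * 2 :> rat by apply/eqP.
rewrite -!addrA three -[1 + 1]/2 -mulrDr; congr (_ * _).
rewrite /shift_even mulrDl divff; last by [].
by rewrite (rpredDr _ (rpred1 _)); case: ifP => // _; rewrite addrAC.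
Qed.

(** At 0 the two sides take the values -1/2 and 5/2. *)
Lemma twisted_scaling_not_comm : (a * (t * a * t^-1) != t * a * t^-1 * a)%g.
Proof.
apply/eqP => /(congr1 (fun f => bij_fun f 0)).
rewrite -[LHS]/(3 / 2 * shift_even 2 (shift_even (- 2) (2 / 3 * 0) + 1) + 1).
rewrite -[RHS]/(3 / 2 * shift_even 2 (shift_even (- 2) (2 / 3 * (0 + 1)) + 1)).
by rewrite /shift_even !Qint_def; vm_compute.
Qed.

End RationalPermutations.

(** * The theorem *)

Lemma no_finite_model (n : nat) : 9 <= n ->
  exists (G : groupType) (g : 'I_n.+1 -> G),
    forall (T : finGroupType) (h : 'I_n.+1 -> T), ~ same_quotients g h.
Proof.
move=> n9; exists (bijection rat).
exact: BS23_obstruction twisted_scaling_rel twisted_scaling_not_comm n9.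
Qed.

Theorem theorem1p8 (F : fieldType) :
  (exists n0 : nat, 3 <= n0 <= 348 /\
     forall n : nat, Omega F n <-> 1 <= n <= n0) /\
  (forall n : nat, 349 <= n.+1 ->
     exists (G : groupType) (g : 'I_n.+1 -> G),
       forall T : finGroupType, ~ regraded_by (elementary_grading F g) T).
Proof.
split; last first.
  move=> n n349; have n9 : 9 <= n by rewrite -ltnS; apply: leq_trans n349.
  have [G [g gN]] := no_finite_model n9; exists G, g => T.
  by move=> /regraded_elementaryP[h /gN].
have Omega3 : Omega F 3.
  by apply/Omega_succP => G g; apply: finite_same_quotients3.
have Omega_lt10 n : `[< Omega F n >] -> n <= 9.
  case: n => [//|n] /asboolP/Omega_succP On; rewrite ltnNge; apply/negP => n9.
  have [G [g gN]] := no_finite_model n9.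
  by have [T [h /gN]] := On G g.
have exOmega : exists n, `[< Omega F n >] by exists 3; apply/asboolP.
case: (ex_maxnP exOmega Omega_lt10) => n0 /asboolP On0 n0_max.
exists n0; split.
  by rewrite n0_max ?(leq_trans (Omega_lt10 _ (asboolT On0))) //; apply/asboolP.
move=> n; split=> [On|/andP[n_gt0 le_n]]; last exact: Omega_leq On0.
by rewrite n0_max ?andbT; [case: n On | apply/asboolP].
Qed.
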